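(* Let $(X,d)$ be a metric space. Then: (i) $\upsilon X$ is a realcompactification of $X$ equivalent to the $G_\delta$-closure of $X$ in $s_dX$. (ii) $\upsilon X\subset H(U_d(X))$, where $\upsilon X$ is identified with its equivalent copy in $s_dX$ given by (i). (iii) $X$ is realcompact if and only if $X$ is $G_\delta$-closed in $s_dX$.
   Context: A compactification (resp. realcompactification) of $X$ is a compact Hausdorff (resp. realcompact Tychonoff) space containing $X$ as a dense subspace; $\alpha_1X\le\alpha_2X$ means that there is a continuous map $\alpha_2X\to\alpha_1X$ leaving $X$ pointwise fixed, and the two are equivalent if $\alpha_1X\le\alpha_2X\le\alpha_1X$. $\upsilon X$ is the Hewitt-Nachbin realcompactification of $X$: the (unique up to equivalence) realcompactification to which every continuous function $X\to\mathbb{R}$ extends continuously. $U_d(X)$ is the unital vector lattice of real-valued uniformly continuous functions on $X$. The Samuel compactification $s_dX$ is the smallest compactification of $X$ to which every bounded $f\in U_d(X)$ extends continuously. Every $f\in U_d(X)$ has a unique continuous extension $f^*:s_dX\to\mathbb{R}\cup\{\infty\}$ (one-point compactification of $\mathbb{R}$). The Samuel realcompactification $H(U_d(X))$ (the space of unital vector lattice homomorphisms $U_d(X)\to\mathbb{R}$ with pointwise convergence) is identified with the subspace $H(U_d(X))=\{\xi\in s_dX: f^*(\xi)\neq\infty\text{ for all }f\in U_d(X)\}$ of $s_dX$. For a space $Y\supset X$, the $G_\delta$-closure of $X$ in $Y$ is the set of points $y\in Y$ such that every $G_\delta$-subset of $Y$ containing $y$ meets $X$; $X$ is $G_\delta$-closed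 in $Y$ if it equals its $G_\delta$-closure in $Y$. *)

(* Defs.v *)
From mathcomp Require Import all_boot all_order all_algebra.
From mathcomp Require Import all_classical all_reals all_analysis.
From mathcomp Require Import borel_hierarchy.

Set Implicit Arguments.
Unset Strict Implicit.
Unset Printing Implicit Defensive.

Import Order.TTheory GRing.Theory Num.Theory.
Import numFieldNormedType.Exports.

Local Open Scope classical_set_scope.
Local Open Scope ring_scope.

(* An extension Y of a space X is given by a map [i : X -> Y] that is a
   homeomorphism onto its image, instead of a literal inclusion of X in Y. *)

Definition tychonoff_space (T : topologicalType) : Prop :=
  hausdorff_space T /\ completely_regular_space T.

Definition topological_embedding (X Y : topologicalType) (i : X -> Y) : Prop :=
  injective i /\
  forall U : set X, open U <-> exists2 V : set Y, open V & i @^-1` V = U.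

(* Homeomorphic to a closed subspace of a power of the real line. *)
Definition realcompact (R : realType) (X : topologicalType) : Prop :=
  exists (I : Type) (e : X -> {ptws I -> R}),
    topological_embedding e /\ closed (range e).

Definition dense_embedding (X Y : topologicalType) (i : X -> Y) : Prop :=
  topological_embedding i /\ dense (range i).

Definition compactification (X Y : topologicalType) (i : X -> Y) : Prop :=
  [/\ compact [set: Y], hausdorff_space Y & dense_embedding i].

Definition realcompactification (R : realType) (X Y : topologicalType)
    (i : X -> Y) : Prop :=
  [/\ realcompact R Y, tychonoff_space Y & dense_embedding i].

(* [ext_le i1 i2]: the extension i1 of X is below the extension i2. *)
Definition ext_le (X Y1 Y2 : topologicalType) (i1 : X -> Y1) (i2 : X -> Y2)
    : Prop :=
  exists2 h : Y2 -> Y1, continuous h & forall x, h (i2 x) = i1 x.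

Definition ext_equiv (X Y1 Y2 : topologicalType) (i1 : X -> Y1) (i2 : X -> Y2)
    : Prop :=
  ext_le i1 i2 /\ ext_le i2 i1.

Definition extends_continuously (X Y Z : topologicalType) (i : X -> Y)
    (f : X -> Z) : Prop :=
  exists2 g : Y -> Z, continuous g & forall x, g (i x) = f x.

(* [hewitt_realcompactification R i]: (Y, i) is the Hewitt-Nachbin
   realcompactification of X, which is determined up to [ext_equiv]. *)
Definition hewitt_realcompactification (R : realType) (X Y : topologicalType)
    (i : X -> Y) : Prop :=
  realcompactification R i /\
  forall f : X -> R, continuous f -> extends_continuously i f.

Definition extends_bounded_unif_continuous (R : realType) (X : metricType R)
    (Y : topologicalType) (i : X -> Y) : Prop :=
  forall f : X -> R, unif_continuous f -> bounded_fun f ->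
    extends_continuously i f.

(* [samuel_compactification j]: (S, j) is the Samuel compactification of the
   metric space X, which is determined up to [ext_equiv]. *)
Definition samuel_compactification (R : realType) (X : metricType R)
    (S : topologicalType) (j : X -> S) : Prop :=
  [/\ compactification j,
      extends_bounded_unif_continuous j
    & forall (Z : topologicalType) (k : X -> Z),
        compactification k -> extends_bounded_unif_continuous k -> ext_le j k].

(* The Samuel realcompactification, as a subset of the Samuel compactification
   (S, j).  Here [fs] is the continuous extension of f to a map from S to the
   one-point compactification of R, unique since X is dense in S; the points of
   R are of the form [Some r], and [None] is the point at infinity. *)
Definition samuel_realcompactification (R : realType) (X : metricType R)
    (S : topologicalType) (j : X -> S) : set S :=
  [set xi | forall f : X -> R, unif_continuous f ->
     exists fs : S -> one_point_compactification R,
       [/\ continuous fs, forall x, fs (j x) = Some (f x) & fs xi <> None]].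

Definition Gdelta_closure (Y : topologicalType) (A : set Y) : set Y :=
  [set y | forall G : set Y, Gdelta G -> G y -> G `&` A !=set0].

Lemma sub_Gdelta_closure (Y : topologicalType) (A : set Y) :
  A `<=` Gdelta_closure A.
Proof. by move=> y Ay G _ Gy; exists y. Qed.

(* The embedding of X into the Gdelta-closure of its image, the latter being a
   topological space for the subspace topology of [set_type]. *)
Definition to_Gdelta_closure (X S : topologicalType) (j : X -> S) (x : X)
    : set_type (Gdelta_closure (range j)) :=
  SigSub (mem_set (sub_Gdelta_closure (imageT j x))).

(* Main.v *)
Require Import Defs.
From mathcomp Require Import all_boot all_order all_algebra.
From mathcomp Require Import all_classical all_reals all_analysis.
From mathcomp Require Import borel_hierarchy lra ring.

Import Order.TTheory GRing.Theory Num.Theory.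
Import numFieldNormedType.Exports.

Local Open Scope classical_set_scope.
Local Open Scope ring_scope.

(** Write G for the Gdelta-closure of X in its Samuel compactification S.

    The point of passing to G is that countably many continuous real functions
    on S cannot tell a point p of G from the points of X: their common level
    set at p is a Gdelta, so it meets X ([Gdelta_closure_agree]).  The point of
    X being metric is that every closed subset of X is the zero set of a bounded
    uniformly continuous function, the distance to it cut off at 1, and such a
    function extends to S.

    Together these show that every continuous f : X -> R extends to G
    ([extends_to_Gdelta_closure]).  Let h range over the extensions of the
    capped distances to the closed sets {f <= q} and {f >= q}, q rational.  For
    p in G choose x in X at which all these h take the same values as at p.
    Since the signs of the h decide where f lies with respect to each rational,
    f x is the limit of f at p, and it is the value of the extension at p.

    The space G is realcompact ([realcompact_Gdelta_closure]).  Evaluation at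
    all continuous functions embeds G in a power of R.  A point in the closure
    of the image comes from a point p of S, by compactness; if p were not in G,
    then there would be a continuous K : S -> R with K p = 0 and K > 0 on G
    ([notin_Gdelta_closure]), and the coordinate 1 / K would have to take an
    infinite value at that point.

    Maps to a realcompact space extend, coordinate by coordinate, along a dense
    embedding along which real functions extend ([realcompact_lift]).  Hence any
    two Hewitt-Nachbin realcompactifications are equivalent, and G is one.  And
    if X is realcompact, then the identity of X extends to a retraction G -> X,
    which must be the identity as X is dense in G: so X = G.

    That G lies in the Samuel realcompactification is
    [Gdelta_closure_sub_samuel].  For this, the one-point compactification of R
    is seen as the circle u ^ 2 + v ^ 2 = v, on which a real t is the point
    (t / (1 + t ^ 2), 1 / (1 + t ^ 2)) and infinity is the origin.  Both
    coordinates of a uniformly continuous f are bounded and uniformly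
    continuous, so f extends to S.  At a point p of G the coordinate v agrees
    with its value at some point of X, which is positive: the extension is
    finite at p. *)

(** * Distance to a set, capped at 1 *)

(** Capping makes the function bounded, and also real-valued when [A] is empty,
    where [edist_inf] is infinite. *)
Definition capped_dist {R : realType} {T : pseudoMetricType R} (A : set T)
    (z : T) : R :=
  fine (Order.min (edist_inf A z) 1%:E).

Section capped_dist.
Context {R : realType} {T : pseudoMetricType R} (A : set T).

Lemma capped_dist_ge0 z : 0 <= capped_dist A z.
Proof. by rewrite fine_ge0// le_min edist_inf_ge0 lee_fin ler01. Qed.

Lemma capped_distE z : (capped_dist A z)%:E = Order.min (edist_inf A z) 1%:E.
Proof.
rewrite fineK// ge0_fin_numE ?le_min ?edist_inf_ge0 ?lee_fin ?ler01//.
by rewrite gt_min ltry orbT.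
Qed.

Lemma capped_dist_le1 z : capped_dist A z <= 1.
Proof. by rewrite -lee_fin capped_distE ge_min lexx orbT. Qed.

Lemma capped_dist_eq0 z : A z -> capped_dist A z = 0.
Proof. by move=> Az; rewrite /capped_dist edist_inf0// min_l ?lee_fin. Qed.

Lemma capped_dist_gt0 z : closed A -> ~ A z -> 0 < capped_dist A z.
Proof.
move=> cA nAz; have : open (~` A) by exact: closed_openC.
rewrite openE => /(_ z nAz)/nbhs_ballP[e /= e0 zeA].
rewrite -lte_fin capped_distE lt_min lte_fin ltr01 andbT.
apply: (@lt_le_trans _ _ e%:E); first by rewrite lte_fin.
apply: le_ereal_inf_tmp => _ [a Aa <-].
rewrite leNgt; apply/negP => /edist_lt_ball/= za.
by apply: (zeA a) => //; exact: za.
Qed.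

Lemma capped_dist_lip x y e : 0 < e -> ball x e y ->
  `|capped_dist A x - capped_dist A y| <= e.
Proof.
move=> e0.
suff H a b : ball a e b -> capped_dist A a <= e + capped_dist A b.
  move=> xy; have yx := ball_sym xy.
  by have := H x y xy; have := H y x yx; rewrite ler_norml; lra.
move=> ab; rewrite -lee_fin EFinD !capped_distE.
have /(edist_fin e0) de : ball (a, b).1 e (a, b).2 by [].
rewrite [in leRHS]/Order.min; case: ifPn => _.
  rewrite ge_min (le_trans (edist_inf_triangle A a b))// leeD2r//.
by rewrite ge_min -EFinD !lee_fin lerDr (ltW e0) orbT.
Qed.

Lemma capped_dist_unif_continuous : unif_continuous (capped_dist A).
Proof.
apply/unif_continuousP => e e0; have e20 : 0 < e / 2 by rewrite divr_gt0.
exists (e / 2) => // -[x y] /(capped_dist_lip _ _ _ e20)/= xy.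
by rewrite /ball/= (le_lt_trans xy)// ltr_pdivrMr// ltr_pMr// ltr1n.
Qed.

Lemma capped_dist_continuous : continuous (capped_dist A).
Proof.
move=> z; apply/cvgrPdist_le => e e0; near=> t.
apply: capped_dist_lip => //; near: t.
exact: nbhsx_ballx.
Unshelve. all: by end_near. Qed.

Lemma capped_dist_bounded : bounded_fun (capped_dist A).
Proof.
exists 1; split => // M M1 z _ /=.
by rewrite ger0_norm ?capped_dist_ge0// (le_trans (capped_dist_le1 z))// ltW.
Qed.

End capped_dist.

(** * Powers of a space *)

Lemma ptws_continuous {T : topologicalType} {I : Type} {Y : topologicalType}
    (f : T -> {ptws I -> Y}) :
  (forall i, continuous (fun x => f x i)) -> continuous f.
Proof.
move=> cf x; apply/cvg_sup => i; move: x.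
apply/(@continuousP _ (initial_topology (fun g : I -> Y => g i))).
move=> _ [B oB <-].
by have /continuousP := cf i; apply.
Qed.

Lemma ptws_proj_continuous {I : Type} {Y : topologicalType} (i : I) :
  continuous (fun f : {ptws I -> Y} => f i).
Proof.
move=> f; have /cvg_sup /(_ i) fi : nbhs f --> f by [].
apply: cvg_trans (cvg_app _ fi) _.
exact: (@initial_continuous _ _ (fun g : I -> Y => g i)).
Qed.

(** * Level sets of countably many functions *)

(** The functions [h i] are the coordinates of a map to a countable power of the
    real line.  That power is pseudometrizable, so the distance from the image
    of [p], composed with this map, does the work of the usual weighted series
    of the differences of [h i x] and [h i p]. *)
Lemma countable_joint_level_function {R : realType} {T : topologicalType}
    {I : countType} (h : I -> T -> R) (p : T) :
  (forall i, continuous (h i)) ->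
  exists K : T -> R, [/\ continuous K, forall x, 0 <= K x, K p = 0 &
    forall x, K x = 0 -> forall i, h i x = h i p].
Proof.
move=> ch; pose H (x : T) : {ptws I -> R} := fun i => h i x.
have cH : continuous H by exact: ptws_continuous.
exists (fun x => capped_dist [set H p] (H x)); split.
- move=> x; apply: continuous_comp; first exact: cH.
  exact: capped_dist_continuous.
- by move=> x; exact: capped_dist_ge0.
- exact: capped_dist_eq0.
- move=> x K0 i; suff : H x = H p by move/(congr1 (fun f => f i)).
  apply: contrapT => Hxp.
  have /capped_dist_gt0 : closed [set H p].
    apply: accessible_closed_set1; apply: hausdorff_accessible.
    by apply: (@hausdorff_product I (fun=> R)) => _; exact: norm_hausdorff.
  by move=> /(_ _ Hxp); rewrite K0 ltxx.
Qed.

Section Gdelta_closure.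
Context {R : realType} {T : topologicalType} (A : set T).

Lemma Gdelta_zero_set (K : T -> R) : continuous K -> Gdelta (K @^-1` [set 0]).
Proof.
move=> cK; exists (fun n => K @^-1` ball (0 : R) n.+1%:R^-1).
  by move=> n; apply: open_comp => [x _|]; [exact: cK|exact: ball_open].
apply/seteqP; split => [x /= Kx n _|x Kx] /=.
  by rewrite /ball/= sub0r normrN Kx normr0 invr_gt0.
apply: contrapT => /eqP; rewrite -normr_gt0 => Kx0.
have := Kx (Num.truncn `|K x|^-1) I.
rewrite /ball/= sub0r normrN ltNge => /negP.
by apply; rewrite invf_ple ?posrE// ltW// truncnS_gt.
Qed.

(** The common level set of the [h i] at [p] is a Gdelta containing [p]. *)
Lemma Gdelta_closure_agree (I : countType) (h : I -> T -> R) (p : T) :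
  (forall i, continuous (h i)) -> Gdelta_closure A p ->
  exists2 a, A a & forall i, h i a = h i p.
Proof.
move=> /(countable_joint_level_function h p)[K [cK _ Kp Kh]] Ap.
have [a [/= Ka Aa]] := Ap _ (Gdelta_zero_set _ cK) Kp.
by exists a => //; exact: Kh.
Qed.

Lemma Gdelta_closure_agree1 (h : T -> R) (p : T) :
  continuous h -> Gdelta_closure A p -> exists2 a, A a & h a = h p.
Proof.
move=> ch /(Gdelta_closure_agree unit (fun=> h) p (fun=> ch))[a Aa ha].
by exists a => //; exact: ha tt.
Qed.

(** Separate [p] by continuous functions from the complements of the open sets
    whose intersection contains [p] and misses [A]; no point of [A] has all the
    values that these functions take at [p].  The function [K] that detects
    their common level set is therefore positive on [A], and then on its
    Gdelta-closure, where it takes no value that it does not take on [A]. *)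
Lemma notin_Gdelta_closure (p : T) :
  completely_regular_space T -> ~ Gdelta_closure A p ->
  exists K : T -> R, [/\ continuous K, K p = 0 &
    forall q, Gdelta_closure A q -> 0 < K q].
Proof.
move=> crT /existsNP[G /not_implyP[[F oF ->] /not_implyP[Fp FA]]].
have h_ n : exists f : T -> R,
    [/\ continuous f, f p = 0 & forall x, ~ F n x -> f x = 1].
  have : uniform_separator [set p] (~` F n).
    by apply: crT; [exact: open_closedC|move=> /(_ (Fp n I))].
  move=> /(@uniform_separatorP _ R)[f [cf _ f0 f1]]; exists f; split => //.
    by apply: f0; exists p.
  by move=> x Fx; apply: f1; exists x.
have [h hP] := choice h_.
have ch n : continuous (h n) by have [] := hP n.
have [K [cK K0 Kp Kh]] := countable_joint_level_function h p ch.
exists K; split => // q /(Gdelta_closure_agree1 _ _ cK)[a Aa <-].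
rewrite lt_neqAle K0 andbT eq_sym; apply/eqP => /Kh ha.
apply: FA; exists a; split => // n _; apply: contrapT => Fa.
have [_ hp h1] := hP n.
by have := ha n; rewrite hp h1// => /eqP; rewrite oner_eq0.
Qed.

End Gdelta_closure.

(** * Subspaces *)

Section subspace.
Context {R : realType} {T : topologicalType} (A : set T).

Lemma set_val_continuous : continuous (set_val : set_type A -> T).
Proof. exact: initial_continuous. Qed.

Lemma set_type_openP (U : set (set_type A)) :
  open U <-> exists2 V : set T, open V & set_val @^-1` V = U.
Proof. by []. Qed.

Lemma set_type_hausdorff : hausdorff_space T -> hausdorff_space (set_type A).
Proof.
move=> hT p q pq; apply: val_inj; apply: hT => U V Up Vq.
have [||y [Uy Vy]] := pq (set_val @^-1` U) (set_val @^-1` V).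
- exact: set_val_continuous Up.
- exact: set_val_continuous Vq.
- by exists (set_val y).
Qed.

Lemma set_type_completely_regular :
  completely_regular_space T -> completely_regular_space (set_type A).
Proof.
move=> crT a B /closed_openC/set_type_openP[V oV VB] nBa.
have Va : V (set_val a) by have : (~` B) a by []; rewrite -VB.
have : uniform_separator [set set_val a] (~` V).
  by apply: crT => [|]; [exact: open_closedC|exact].
move=> /(@uniform_separatorP _ R)[f [cf f01 f0 f1]].
apply/(@uniform_separatorP _ R); exists (f \o set_val); split.
- by move=> x; apply: continuous_comp; [exact: set_val_continuous|exact: cf].
- by move=> _ [x _ <-]; apply: f01; exists (set_val x).
- by move=> _ [x -> <-]; apply: f0; exists (set_val a).
- move=> _ [x Bx <-]; apply: f1; exists (set_val x) => //= Vx.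
  by have : (set_val @^-1` V) x by []; rewrite VB.
Qed.

End subspace.

(** * Embedding in a power of the real line *)

Lemma compact_hausdorff_completely_regular {R : realType}
    {T : topologicalType} :
  compact [set: T] -> hausdorff_space T -> completely_regular_space T.
Proof.
move=> cT hT; apply: (@normal_completely_regular R).
  exact: compact_normal.
exact: hausdorff_accessible.
Qed.

Lemma embedding_continuous {X Y : topologicalType} (i : X -> Y) :
  topological_embedding i -> continuous i.
Proof. by move=> [_ oi]; apply/continuousP => V oV; apply/oi; exists V. Qed.

Definition evaluation (R : realType) (Y : topologicalType) (y : Y) :
    {ptws {g : Y -> R | continuous g} -> R} :=
  fun g => sval g y.

Lemma evaluation_embedding (R : realType) (Y : topologicalType) :
  tychonoff_space Y -> topological_embedding (evaluation R Y).
Proof.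
move=> [hY crY].
have sep y (U : set Y) : open U -> U y ->
    exists g : {g : Y -> R | continuous g},
      sval g y = 0 /\ forall z, ~ U z -> sval g z = 1.
  move=> oU Uy; have : uniform_separator [set y] (~` U).
    by apply: crY => [|]; [exact: open_closedC|exact].
  move=> /(@uniform_separatorP _ R)[f [cf _ f0 f1]]; exists (exist _ f cf).
  by split => [|z Uz]; [apply: f0; exists y|apply: f1; exists z].
split.
  move=> x y exy; apply: contrapT => /eqP xy.
  have [U [oU /set_mem Ux /set_mem nUy]] := hausdorff_accessible hY xy.
  have [g [gx /(_ _ nUy) gy]] := sep x U oU Ux.
  have : evaluation R Y x g = evaluation R Y y g by rewrite exy.
  by rewrite /evaluation gx gy => /esym/eqP; rewrite oner_eq0.
move=> U; split; last first.
  move=> [V oV <-]; apply: open_comp => // y _.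
  by move: y; apply: ptws_continuous => g; exact: (svalP g).
move=> oU; exists (\bigcup_(g in [set g : {g : Y -> R | continuous g} |
    forall z, ~ U z -> sval g z = 1])
    (fun phi : {ptws {g : Y -> R | continuous g} -> R} => phi g)
      @^-1` [set r | r < 1]).
  apply: bigcup_open => g _; apply: open_comp; last exact: open_lt.
  by move=> phi _; exact: ptws_proj_continuous.
apply/seteqP; split => [y [g /= gU gy]|y Uy].
  apply: contrapT => /gU; rewrite /evaluation/= in gy * => gy1.
  by rewrite gy1 ltxx in gy.
by have [g [gy gU]] := sep y U oU Uy; exists g => //=; rewrite /evaluation gy.
Qed.

Lemma tychonoff_set_type {R : realType} {T : topologicalType} (A : set T) :
  compact [set: T] -> hausdorff_space T -> tychonoff_space (set_type A).
Proof.
move=> cT hT; split; first exact: set_type_hausdorff.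
apply: (@set_type_completely_regular R).
exact: (@compact_hausdorff_completely_regular R).
Qed.

(** The image of the evaluation map is closed: if a limit of its points came from
    a point of T outside the Gdelta-closure, then the coordinate 1 / K, for the
    K of [notin_Gdelta_closure], would be infinite at this limit. *)
Lemma realcompact_Gdelta_closure (R : realType) (T : topologicalType)
    (A : set T) :
  compact [set: T] -> hausdorff_space T ->
  realcompact R (set_type (Gdelta_closure A)).
Proof.
move=> cT hT; set G := Gdelta_closure A.
exists {g : set_type G -> R | continuous g}, (evaluation R (set_type G)).
split; first exact/evaluation_embedding/(@tychonoff_set_type R).
move=> phi clphi.
(* The trace on T of the neighborhoods of phi; it clusters by compactness. *)
pose F := filter_from (nbhs phi)
  (fun V => set_val @` (evaluation R (set_type G) @^-1` V)).
have FF : ProperFilter F.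
  apply: filter_from_proper.
    apply: filter_from_filter; first by exists setT; exact: filterT.
    move=> V W Vphi Wphi; exists (V `&` W); first exact: filterI.
    by move=> _ [y [Vy Wy] <-]; split; exists y.
  by move=> V /clphi[_ [[y _ <-] Vy]]; exists (set_val y), y.
have [p [_ clp]] : [set: T] `&` cluster F !=set0.
  by apply: cT; exists setT; [exact: filterT|].
(* The cluster point p and phi are approached by the same points of G. *)
have close (g : {g : set_type G -> R | continuous g}) (e : R) (W : set T) :
    0 < e -> nbhs p W ->
    exists y, W (set_val y) /\ `|phi g - sval g y| < e.
  move=> e0 Wp.
  have Vphi : nbhs phi [set psi | `|phi g - psi g| < e].
    exact: (ptws_proj_continuous g phi _ (nbhsx_ballx (phi g) e e0)).
  have [|_ [[y /= gy <-] Wy]] := clp (set_val @`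
      (evaluation R (set_type G) @^-1` [set psi | `|phi g - psi g| < e])) W _ Wp.
    by eexists; first exact: Vphi.
  by exists y.
(* If p is in G, then each g takes at p the value of phi at g. *)
have [Gp|nGp] := pselect (G p).
  exists (SigSub (mem_set Gp)) => //; apply/funext => g.
  apply: contrapT => /eqP gp.
  pose y0 : set_type G := SigSub (mem_set Gp).
  pose e := `|evaluation R (set_type G) y0 g - phi g| / 2.
  have e0 : 0 < e by rewrite divr_gt0// normr_gt0 subr_eq0.
  have /= : nbhs y0 (sval g @^-1` ball (sval g y0) e).
    by apply: (svalP g); exact: nbhsx_ballx.
  case=> _ [[W oW <-] /= Wp WU].
  have [y [Wy gy]] := close g e W e0 (open_nbhs_nbhs (conj oW Wp)).
  have := WU y Wy; rewrite /ball/= => gy0.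
  have := ler_distD (sval g y) (sval g y0) (phi g).
  rewrite (distrC (sval g y)) => /le_lt_trans/(_ (ltrD gy0 gy)).
  by rewrite /e -splitr ltxx.
have [|K [cK Kp KG]] := notin_Gdelta_closure (R := R) A p _ nGp.
  exact: (@compact_hausdorff_completely_regular R).
have Kpos (y : set_type G) : 0 < K (set_val y).
  by apply: KG; exact: set_valP.
have cg : continuous (fun y : set_type G => (K (set_val y))^-1).
  move=> y; apply: continuousV; first by rewrite gt_eqF.
  by apply: continuous_comp; [exact: set_val_continuous|exact: cK].
pose g : {g : set_type G -> R | continuous g} := exist _ _ cg.
(* Near p, the function g exceeds M, so it is not within 1 of phi g. *)
pose M := `|phi g| + 1; have M0 : 0 < M by rewrite ltr_wpDl.
have Mi0 : 0 < M^-1 by rewrite invr_gt0.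
have [|y [/= Wy gy]] := close g 1 (K @^-1` ball (K p) M^-1) ltr01.
  by apply: cK; exact: nbhsx_ballx.
have K0 := Kpos y.
move: Wy; rewrite Kp /ball/= sub0r normrN gtr0_norm// => /ltW.
rewrite -[leLHS]invrK lef_pV2 ?posrE ?invr_gt0// leNgt => /negP[].
rewrite -[ltLHS](gtr0_norm (x := (K (set_val y))^-1)) ?invr_gt0//.
rewrite -[X in `|X|](subrK (phi g)) (le_lt_trans (ler_normD _ _))//.
by rewrite addrC ltrD2l distrC.
Qed.

(** With Y2 a closed subset of a power of R, each coordinate of [i2] extends to
    Y1; the resulting map stays in Y2 because [i1] has dense range. *)
Lemma realcompact_lift (R : realType) (X Y1 Y2 : topologicalType)
    (i1 : X -> Y1) (i2 : X -> Y2) :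
  dense (range i1) ->
  (forall f : X -> R, continuous f -> extends_continuously i1 f) ->
  realcompact R Y2 -> continuous i2 -> ext_le i2 i1.
Proof.
move=> di1 ext [I [e [eemb ecl]]] ci2; have [einj eopen] := eemb.
have /choice[g gP] k : exists gk : Y1 -> R,
    continuous gk /\ forall x, gk (i1 x) = e (i2 x) k.
  have [|gk cgk gki] := ext (fun x => e (i2 x) k); last by exists gk.
  move=> x; apply: (@continuous_comp _ _ _ i2 (fun y => e y k)).
    exact: ci2.
  apply: (@continuous_comp _ _ _ e (fun psi : {ptws I -> R} => psi k)).
    exact: embedding_continuous.
  exact: ptws_proj_continuous.
pose G (y : Y1) : {ptws I -> R} := fun k => g k y.
have cG : continuous G by apply: ptws_continuous => k; have [] := gP k.
have Gi x : G (i1 x) = e (i2 x) by apply/funext => k; exact: (gP k).2.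
have /choice[h hP] y : exists z, e z = G y.
  apply: contrapT => ny.
  have [||w [nw [x _ xw]]] := di1 (~` (G @^-1` range e)).
  - by exists y => -[z _ zy]; apply: ny; exists z.
  - by apply: closed_openC; exact: (continuous_closedP _).1 cG _ ecl.
  - by apply: nw; rewrite -xw/= Gi; exists (i2 x).
exists h; last by move=> x; apply: einj; rewrite hP Gi.
apply/continuousP => U /eopen[V oV <-].
have -> : h @^-1` (e @^-1` V) = G @^-1` V.
  by apply/seteqP; split => y /=; rewrite hP.
by apply: open_comp.
Qed.

(** * The Gdelta-closure as an extension *)

Lemma dense_continuous_eq {T U : topologicalType} (A : set T) (f g : T -> U) :
  hausdorff_space U -> dense A -> continuous f -> continuous g ->
  (forall x, A x -> f x = g x) -> f = g.
Proof.
move=> hU dA cf cg fg; apply/funext => x; apply: hU => V W Vf Wg.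
have VW : nbhs x (f @^-1` V `&` g @^-1` W).
  by apply: filterI; [exact: cf|exact: cg].
have [||y [/interior_subset[Vy Wy] Ay]] := dA (f @^-1` V `&` g @^-1` W)°.
- by exists x.
- exact: open_interior.
by exists (f y); split => //; rewrite fg.
Qed.

Section to_Gdelta_closure.
Context {X S : topologicalType} (j : X -> S).

Lemma to_Gdelta_closure_embedding :
  topological_embedding j -> topological_embedding (to_Gdelta_closure j).
Proof.
move=> [jinj jopen]; split; first by move=> x y [] /jinj.
move=> U; split.
  by move=> /jopen[V oV <-]; exists (set_val @^-1` V) => //; exists V.
by move=> [_ [V oV <-] <-]; apply/jopen; exists V.
Qed.

Lemma to_Gdelta_closure_dense :
  dense (range j) -> dense (range (to_Gdelta_closure j)).
Proof.
move=> dj U [y Uy] [V oV VU].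
have [|s [Vs [x _ xs]]] := dj V _ oV.
  by exists (set_val y); rewrite -VU in Uy.
exists (to_Gdelta_closure j x); split; last by exists x.
by rewrite -VU /= set_valE /= xs.
Qed.

End to_Gdelta_closure.

(** The value of the extension at [y] is [f (pt y)], where [pt y] is a point of
    X at which countably many functions on S, chosen for [f], have the same values
    as at [y].  These functions determine the position of [f (pt y)] among the
    rationals, so the value depends only on [y]; and they are continuous, so
    that a strict rational bound on this value persists near [y]. *)
Lemma extends_to_Gdelta_closure {R : realType} {X : metricType R}
    {S : topologicalType} (j : X -> S) (f : X -> R) :
  extends_bounded_unif_continuous j -> continuous f ->
  extends_continuously (to_Gdelta_closure j) f.
Proof.
move=> ext cf.
pose D (k : bool * rat) : set X :=
  if k.1 then [set x | f x <= ratr k.2] else [set x | ratr k.2 <= f x].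
have cD k : closed (D k).
  have /continuous_closedP cfP := cf.
  case: k => -[] q; rewrite /D/=; first exact: (cfP _ (@closed_le _ _)).
  exact: (cfP _ (@closed_ge _ _)).
have /choice[h hP] k : exists hk : S -> R,
    continuous hk /\ forall x, hk (j x) = capped_dist (D k) x.
  have [||hk] := ext (capped_dist (D k)); last by exists hk.
  - exact: capped_dist_unif_continuous.
  - exact: capped_dist_bounded.
have ch k : continuous (h k) by exact: (hP k).1.
have /choice[pt ptP] (y : set_type (Gdelta_closure (range j))) :
    exists x, forall k, h k (set_val y) = h k (j x).
  have [_ [x _ <-] hx] := Gdelta_closure_agree _ _ _ _ ch (set_valP y).
  by exists x.
have ptD k y : 0 < h k (set_val y) <-> ~ D k (pt y).
  rewrite ptP (hP k).2; split=> [+ Dx|]; last exact: capped_dist_gt0.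
  by rewrite capped_dist_eq0// ltxx.
have fpt x : f (pt (to_Gdelta_closure j x)) = f x.
  set x' := pt _.
  have DD k : D k x' <-> D k x.
    have := ptD k (to_Gdelta_closure j x); rewrite set_valE/= (hP k).2 => xx'.
    split=> Dx; apply: contrapT => nDx.
      by have := capped_dist_gt0 _ _ (cD k) nDx => /xx'; exact.
    by move/xx' : nDx; rewrite capped_dist_eq0// ltxx.
  have [/rat_in_itvoo[q]|/rat_in_itvoo[q]|//] := ltgtP (f x') (f x);
      rewrite in_itv/= => /andP[].
    move=> /ltW xq qx; have := (DD (true, q)).1 xq.
    by rewrite /D/= leNgt qx.
  move=> /ltW xq qx; have := (DD (true, q)).2 xq.
  by rewrite /D/= leNgt qx.
exists (f \o pt) => // y.
apply/(@cvgrPdist_lt _ _ _ (nbhs y) (nbhs_filter y)) => e e0 /=.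
have [q1] : exists q, ratr q \in `](f (pt y) - e), (f (pt y))[.
  by apply: rat_in_itvoo; rewrite ltrBlDr ltrDl.
have [q2] : exists q, ratr q \in `](f (pt y)), (f (pt y) + e)[.
  by apply: rat_in_itvoo; rewrite ltrDl.
rewrite !in_itv/= => /andP[yq2 q2e] /andP[q1e yq1].
have nearD k : ~ D k (pt y) -> \forall z \near y, ~ D k (pt z).
  move=> /ptD hk0.
  have hk : {for y, continuous (h k \o set_val)}.
    by apply: continuous_comp; [exact: set_val_continuous|exact: ch].
  have hy : nbhs y [set z | 0 < h k (set_val z)] by exact: cvgr_gt hk _ hk0.
  by apply: (filterS (F := nbhs y) _ hy) => z /ptD.
have n1 : ~ D (true, q1) (pt y) by rewrite /D/= leNgt yq1.
have n2 : ~ D (false, q2) (pt y) by rewrite /D/= leNgt yq2.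
move: (nearD _ n1) (nearD _ n2); apply: filterS2 => z /negP + /negP.
rewrite /D/= -!ltNge => q1z zq2.
by rewrite ltr_norml; lra.
Qed.

(** * Extensions to the one-point compactification *)

(** The map t |-> (t / (1 + t ^ 2), 1 / (1 + t ^ 2)) sends the real line to the
    circle u ^ 2 + v ^ 2 = v without the origin.  Its coordinates are bounded
    and nonexpansive, so that those of a uniformly continuous function extend to
    the Samuel compactification. *)
Section circle.
Context {R : realType}.
Implicit Types s t : R.

Lemma circle_fst_bound t : `|t / (1 + t ^+ 2)| <= 1.
Proof.
have d0 : 0 < 1 + t ^+ 2 by nra.
rewrite normrM [`|_^-1|]gtr0_norm ?invr_gt0// ler_pdivrMr// mul1r ler_norml.
by apply/andP; split; nra.
Qed.

Lemma circle_snd_bound t : `|(1 + t ^+ 2)^-1| <= 1.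
Proof.
have d0 : 0 < 1 + t ^+ 2 by nra.
by rewrite gtr0_norm ?invr_gt0// invf_le1//; nra.
Qed.

Lemma circle_fst_lip s t : `|s / (1 + s ^+ 2) - t / (1 + t ^+ 2)| <= `|s - t|.
Proof.
have s0 : 0 < 1 + s ^+ 2 by nra.
have t0 : 0 < 1 + t ^+ 2 by nra.
have -> : s / (1 + s ^+ 2) - t / (1 + t ^+ 2) =
    (s - t) * ((1 - s * t) / ((1 + s ^+ 2) * (1 + t ^+ 2))).
  by field; rewrite !gt_eqF.
rewrite normrM ler_piMr// normrM [`|_^-1|]gtr0_norm ?invr_gt0 ?mulr_gt0//.
rewrite ler_pdivrMr ?mulr_gt0// mul1r ler_norml.
have := sqr_ge0 (s + t); have := sqr_ge0 (s - t); have := sqr_ge0 (s * t).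
by rewrite !expr2 => ? ? ?; apply/andP; split; lra.
Qed.

Lemma circle_snd_lip s t : `|(1 + s ^+ 2)^-1 - (1 + t ^+ 2)^-1| <= `|s - t|.
Proof.
have s0 : 0 < 1 + s ^+ 2 by nra.
have t0 : 0 < 1 + t ^+ 2 by nra.
have -> : (1 + s ^+ 2)^-1 - (1 + t ^+ 2)^-1 =
    (s - t) * (- (s + t) / ((1 + s ^+ 2) * (1 + t ^+ 2))).
  by field; rewrite !gt_eqF.
rewrite normrM ler_piMr// normrM [`|_^-1|]gtr0_norm ?invr_gt0 ?mulr_gt0//.
rewrite ler_pdivrMr ?mulr_gt0// mul1r ler_norml.
have := sqr_ge0 (s + 2^-1); have := sqr_ge0 (t + 2^-1).
have := sqr_ge0 (s - 2^-1); have := sqr_ge0 (t - 2^-1).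
have := sqr_ge0 (s * t).
by rewrite !expr2 => ? ? ? ? ?; apply/andP; split; lra.
Qed.

Lemma nonexpansive_extends {X : metricType R} {S : topologicalType}
    (j : X -> S) (f : X -> R) (phi : R -> R) :
  extends_bounded_unif_continuous j -> unif_continuous f ->
  (forall t, `|phi t| <= 1) -> (forall s t, `|phi s - phi t| <= `|s - t|) ->
  extends_continuously j (phi \o f).
Proof.
move=> ext /unif_continuousP uf b lip; apply: ext.
  apply/unif_continuousP => e /uf[d d0 df]; exists d => // xy /df.
  by rewrite /ball/=; exact: le_lt_trans.
by exists 1; split => // M M1 x _ /=; rewrite (le_trans (b _))// ltW.
Qed.

(** On the circle, t = u / v is the inverse of the parametrization above, and the
    origin stands for infinity. *)
Lemma circle_quotient_continuous {S : topologicalType} (u v : S -> R) :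
  continuous u -> continuous v -> (forall x, u x ^+ 2 + v x ^+ 2 = v x) ->
  continuous ((fun x => if v x == 0 then None else Some (u x / v x)) :
    S -> one_point_compactification R).
Proof.
move=> cu cv uv x; case: (eqVneq (v x) 0) => vx.
  move=> U; rewrite /= vx eqxx => -[C [/compact_bounded[N [Nr NC]] _] CU].
  pose M := `|N| + 1.
  have CM t : C t -> `|t| <= M.
    by apply: NC; rewrite ltr_pwDr// ler_norm.
  have M0 : 0 < 1 + M ^+ 2 by nra.
  have : \forall z \near x, v z < (1 + M ^+ 2)^-1.
    by apply: (cvgr_lt (v x)); [exact: cv|rewrite vx invr_gt0].
  apply: filterS => z vz /=; case: (eqVneq (v z) 0) => vz0.
    by apply: CU; right.
  apply: CU; left; exists (u z / v z) => // /CM tM.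
  have vpos : 0 < v z by rewrite lt_neqAle eq_sym vz0/= -uv addr_ge0 ?sqr_ge0.
  move: vz; apply/negP; rewrite -leNgt -[X in _ <= X]invrK.
  rewrite lef_pV2 ?posrE ?invr_gt0//.
  (* On the circle 1 / v = 1 + t ^ 2, so |t| <= M keeps v away from 0. *)
  have -> : (v z)^-1 = 1 + (u z / v z) ^+ 2.
    have u2 : u z ^+ 2 = v z - v z ^+ 2 by rewrite -[X in X - _](uv z) addrK.
    by rewrite expr_div_n u2; field.
  have M1 : 0 <= M by rewrite addr_ge0.
  by rewrite lerD2l -[leLHS]real_normK ?num_real// lerXn2r ?nnegrE.
move=> U; rewrite /= (negbTE vx) => Uuv.
have vnear : \forall z \near x, v z != 0 by exact: cvgr_neq0 (cv x) vx.
have uvx : (u z / v z) @[z --> x] --> u x / v x.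
  by apply: cvgM; [exact: cu|exact: (cvgV vx (cv x))].
have Unear : \forall z \near x, (Some @^-1` U) (u z / v z) by exact: uvx.
by apply: filterS2 vnear Unear => z /negbTE /= ->.
Qed.

Lemma Gdelta_closure_sub_samuel {X : metricType R} {S : topologicalType}
    (j : X -> S) :
  dense (range j) -> extends_bounded_unif_continuous j ->
  Gdelta_closure (range j) `<=` samuel_realcompactification j.
Proof.
move=> dj ext p Gp f uf.
have [u cu uj] := nonexpansive_extends _ _ _ ext uf
  circle_fst_bound circle_fst_lip.
have [v cv vj] := nonexpansive_extends _ _ _ ext uf
  circle_snd_bound circle_snd_lip.
have d0 x : 0 < 1 + f x ^+ 2 by nra.
have uv x : u x ^+ 2 + v x ^+ 2 = v x.
  have /(congr1 (fun h => h x)) // : (fun x => u x ^+ 2 + v x ^+ 2) = v.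
  apply: (@dense_continuous_eq _ _ _ _ _ (@norm_hausdorff _ _) dj) => //.
    move=> z; apply: cvgD; first exact: cvgM (cu z) (cu z).
    exact: cvgM (cv z) (cv z).
  move=> _ [z _ <-]; rewrite uj vj/=; have := d0 z.
  by move=> /lt0r_neq0 dz; field.
exists (fun x => if v x == 0 then None else Some (u x / v x)); split.
- exact: circle_quotient_continuous.
- move=> x; rewrite uj vj/= invr_eq0 gt_eqF//; congr Some.
  by rewrite invrK mulfVK ?gt_eqF.
- have [_ [x _ <-]] := Gdelta_closure_agree1 _ _ _ cv Gp.
  by rewrite vj/= => <-; rewrite invr_eq0 gt_eqF.
Qed.

End circle.

Theorem proposition40 (R : realType) (X : metricType R)
    (S : topologicalType) (j : X -> S) (hS : samuel_compactification j) :
  [/\ hewitt_realcompactification R (to_Gdelta_closure j) /\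
      (forall (Y : topologicalType) (i : X -> Y),
         hewitt_realcompactification R i -> ext_equiv i (to_Gdelta_closure j)),
      Gdelta_closure (range j) `<=` samuel_realcompactification j
    & realcompact R X <-> Gdelta_closure (range j) = range j].
Proof.
have [[cS hausS [embj dj]] ext _] := hS.
pose toG := to_Gdelta_closure j.
have embG : topological_embedding toG by exact: to_Gdelta_closure_embedding.
have dG : dense (range toG) by exact: to_Gdelta_closure_dense.
have rcG : realcompact R (set_type (Gdelta_closure (range j))).
  exact: realcompact_Gdelta_closure.
have extG (f : X -> R) : continuous f -> extends_continuously toG f.
  exact: extends_to_Gdelta_closure.
split.
- split.
    by do 2?split => //; exact: (@tychonoff_set_type R).
  move=> Y i [[rcY _ [embi di]] exti]; split.
    apply: realcompact_lift dG extG rcY _.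
    exact: embedding_continuous.
  apply: realcompact_lift di exti rcG _.
  exact: embedding_continuous.
- exact: Gdelta_closure_sub_samuel.
- split=> [rcX|Gj].
    apply/seteqP; split; last exact: sub_Gdelta_closure.
    have [h ch hj] :=
      realcompact_lift R _ _ _ toG id dG extG rcX (fun x => cvg_id).
    (* The retraction h of G onto X is the identity, X being dense in G. *)
    have jh : j \o h = set_val.
      apply: (dense_continuous_eq _ _ _ hausS dG).
      + move=> y; apply: continuous_comp; first exact: ch.
        exact: embedding_continuous.
      + exact: set_val_continuous.
      + by move=> _ [x _ <-] /=; rewrite hj.
    move=> p Gp.
    pose y : set_type (Gdelta_closure (range j)) := SigSub (mem_set Gp).
    by exists (h y) => //; have := congr1 (fun k => k y) jh.
  have [I [e [[einj eopen] ecl]]] := rcG.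
  have [jinj jopen] := embG.
  exists I, (e \o toG); split.
    split; first by move=> x y /einj/jinj.
    move=> U; split.
      by move=> /jopen[V /eopen[W oW <-] <-]; exists W.
    move=> [W oW <-]; apply/jopen; exists (e @^-1` W) => //.
    by apply/eopen; exists W.
  suff -> : range (e \o toG) = range e by [].
  apply/seteqP; split; first by move=> _ [x _ <-]; exists (toG x).
  move=> _ [y _ <-].
  have Gj' : Gdelta_closure (range j) `<=` range j by rewrite Gj.
  have [x _ xy] := Gj' _ (set_valP y).
  exists x => //=; congr e; exact: val_inj.
Qed.
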